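(* Let $\mathcal{E}=\mathcal{A}_1\times\cdots\times\mathcal{A}_d$ be a subset in $\mathbb{F}_q^d$. Suppose that $$\left(\min_{1\le i\le d}|\mathcal{A}_i|\right)^{-1}|\mathcal{E}|^{k+1}\gg q^{kd}.$$ Then, for $1\le k\le d$, the number of congruence classes of $k$-simplices determined by $\mathcal{E}$ is at least $c\,q^{\binom{k+1}{2}}$ for some positive constant $c$.
   Context: $\mathbb{F}_q$ is the finite field of order $q$, where $q=p^r$ for some prime $p$ and positive integer $r$; the sets $\mathcal{A}_1,\ldots,\mathcal{A}_d$ are subsets of $\mathbb{F}_q$. The notation $X\ll Y$ (equivalently $Y\gg X$) means that there exists a constant $C>0$ such that $X\le CY$, where $X,Y$ are viewed as functions in $q$. $O(d,\mathbb{F}_q)$ denotes the orthogonal group in $\mathbb{F}_q^d$, i.e. the group of linear maps of $\mathbb{F}_q^d$ preserving the standard form $x_1^2+\cdots+x_d^2$. A $k$-simplex in $\mathbb{F}_q^d$ is given by its vertices $(\mathbf{x}_1,\ldots,\mathbf{x}_{k+1})$ in $\mathbb{F}_q^d$. Two $k$-simplices with vertices $(\mathbf{x}_1,\ldots,\mathbf{x}_{k+1})$ and $(\mathbf{y}_1,\ldots,\mathbf{y}_{k+1})$ are in the same congruence class if there exist $\theta\in O(d,\mathbb{F}_q)$ and $\mathbf{z}\in\mathbb{F}_q^d$ with $\mathbf{z}+\theta(\mathbf{x}_i)=\mathbf{y}_i$ for all $i=1,\ldots,k+1$. The number of congruence classes of $k$-simplices determined by $\mathcal{E}$ is the number of congruence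 classes containing a $k$-simplex all of whose vertices lie in $\mathcal{E}$.
   Formalization: The formal theorem assumes that q is odd; in characteristic 2 the form x_1^2+...+x_d^2 is the square of a linear form and the claim fails for all d ≥ 2 (e.g. d=2, k=1, A_1=A_2 an additive subgroup of size about q^(5/6)). *)

(* Defs.v *)
From HB Require Import structures.
From mathcomp Require Import all_boot all_order all_algebra.
From mathcomp Require Import reals.

Set Implicit Arguments.
Unset Strict Implicit.
Unset Printing Implicit Defensive.

Import Order.TTheory GRing.Theory Num.Theory.
Local Open Scope ring_scope.

Section Simplices.

Variables (F : finFieldType) (d : nat).

Definition sqform (x : 'cV[F]_d) : F := \sum_i x i 0 ^+ 2.

(* O(d, F); theta acts on column vectors by x |-> theta *m x. *)
Definition orthogonal_group : {set 'M[F]_d} :=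
  [set theta | (theta \in unitmx)
             && [forall x : 'cV[F]_d, sqform (theta *m x) == sqform x]].

Definition cartesian (A : 'I_d -> {set F}) : {set 'cV[F]_d} :=
  [set x : 'cV[F]_d | [forall i, x i 0 \in A i]].

(* The default value #|F| is harmless for d > 0, since #|A i| <= #|F|. *)
Definition min_card (A : 'I_d -> {set F}) : nat :=
  \big[minn/#|F|]_(i < d) #|A i|.

(* Degenerate simplices are allowed: the vertices are arbitrary points. *)
Definition simplex (k : nat) := {ffun 'I_k.+1 -> 'cV[F]_d}.

Variable k : nat.

Definition congruent (x y : simplex k) : bool :=
  [exists theta in orthogonal_group, exists z : 'cV[F]_d,
    [forall i, z + theta *m x i == y i]].

Lemma congruentP (x y : simplex k) :
  reflect (exists theta z, theta \in orthogonal_group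
                           /\ forall i, z + theta *m x i = y i)
          (congruent x y).
Proof.
apply: (iffP existsP) => [[theta /andP[Ot /existsP[z /forallP xy]]] |
                          [theta [z [Ot xy]]]].
  by exists theta, z; split=> // i; apply/eqP.
exists theta; rewrite Ot; apply/existsP; exists z.
by apply/forallP => i; apply/eqP.
Qed.

Lemma congruent_refl : reflexive congruent.
Proof.
move=> x; apply/congruentP; exists 1%:M, 0; split=> [|i].
  by rewrite inE unitmx1; apply/forallP => v; rewrite mul1mx.
by rewrite mul1mx add0r.
Qed.

Lemma congruent_sym : symmetric congruent.
Proof.
suff sym x y : congruent x y -> congruent y x
  by move=> x y; apply/idP/idP; exact: sym.
case/congruentP=> theta [z [/[!inE] /andP[Ut /forallP Ot] xy]].
apply/congruentP; exists (invmx theta), (- (invmx theta *m z)); split=> [|i].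
  rewrite inE unitmx_inv Ut; apply/forallP => v.
  by rewrite -(eqP (Ot (invmx theta *m v))) mulKVmx.
by rewrite -xy mulmxDr mulKmx // addKr.
Qed.

Lemma congruent_trans : transitive congruent.
Proof.
move=> y x w /congruentP[t1 [z1 [/[!inE] /andP[U1 /forallP O1] xy]]].
case/congruentP=> t2 [z2 [/[!inE] /andP[U2 /forallP O2] yw]].
apply/congruentP; exists (t2 *m t1), (z2 + t2 *m z1); split=> [|i].
  rewrite inE unitmx_mul U1 U2; apply/forallP => v.
  by rewrite -mulmxA (eqP (O2 _)) O1.
by rewrite -yw -xy mulmxDr mulmxA addrA.
Qed.

Lemma congruent_equiv :
  {in [set: simplex k] & &, equivalence_rel congruent}.
Proof.
move=> x y w _ _ _; split; first exact: congruent_refl.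
move=> xy; apply/idP/idP; last exact: congruent_trans.
by apply: congruent_trans; rewrite congruent_sym.
Qed.

Definition congruence_classes : {set {set simplex k}} :=
  equivalence_partition congruent [set: simplex k].

Definition determined_classes (E : {set 'cV[F]_d}) : {set {set simplex k}} :=
  [set K in congruence_classes | [exists x : simplex k in K, forall i, x i \in E]].

End Simplices.

(* Main.v *)
(* Let q = |F|, e = |E| and a = min |A_i|.  If nu(theta, z) counts the v in E with
   z + theta v in E, then sum nu^(k+1) counts the pairs of simplices of E together
   with a congruence between them.  Each congruent pair has at least
   |O(d, F)| q^C(k+1,2) / (2 q^d)^k congruences, so an upper bound for the (k+1)-st
   moment of nu bounds the number of congruent pairs, and Cauchy-Schwarz turns this
   into a lower bound for the number of classes.

   The moment is controlled by the variance of nu, which by Fourier analysis is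
   q^-d times the sum over theta and xi != 0 of |E^(xi)|^2 |E^(theta xi)|^2.
   Averaging over theta spreads theta xi over a sphere.  As E is a product and a line
   parallel to a coordinate axis meets a sphere in at most two points, |E^|^2 has mass
   at most 2 q^(d-1) a e on a sphere, which bounds the variance by 5 |O| a e^2. *)

Require Import Defs.
From HB Require Import structures.
From mathcomp Require Import all_boot all_order all_algebra.
From mathcomp Require Import all_fingroup all_solvable all_field all_character.
From mathcomp Require Import reals ring lra zify.

Set Implicit Arguments.
Unset Strict Implicit.
Unset Printing Implicit Defensive.

Import Order.TTheory GRing.Theory Num.Theory.
Local Open Scope ring_scope.

(** * The standard bilinear form, and counting along parallel lines *)

Section DotProduct.

Variables (F : finFieldType) (d : nat).
Implicit Types (x y z w b : 'cV[F]_d) (c : F).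

Definition dot x y : F := \sum_i x i 0 * y i 0.

Lemma dotC x y : dot x y = dot y x.
Proof. by apply: eq_bigr => i _; rewrite mulrC. Qed.

Lemma dotDr x y z : dot x (y + z) = dot x y + dot x z.
Proof. by rewrite -big_split; apply: eq_bigr => i _; rewrite mxE mulrDr. Qed.

Lemma dotDl x y z : dot (y + z) x = dot y x + dot z x.
Proof. by rewrite dotC dotDr !(dotC x). Qed.

Lemma dotZr c x y : dot x (c *: y) = c * dot x y.
Proof. by rewrite mulr_sumr; apply: eq_bigr => i _; rewrite mxE mulrCA. Qed.

Lemma dotZl c x y : dot (c *: x) y = c * dot x y.
Proof. by rewrite dotC dotZr dotC. Qed.

Lemma dotNr x y : dot x (- y) = - dot x y.
Proof. by rewrite -scaleN1r dotZr mulN1r. Qed.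

Lemma dotBr x y z : dot x (y - z) = dot x y - dot x z.
Proof. by rewrite dotDr dotNr. Qed.

Lemma dot0l x : dot 0 x = 0.
Proof. by rewrite -(scale0r 0) dotZl mul0r. Qed.

Lemma dot_delta x i : dot x (delta_mx i 0) = x i 0.
Proof.
rewrite /dot (bigD1 i) //= big1 => [|j ji]; rewrite mxE.
  by rewrite !eqxx mulr1 addr0.
by rewrite (negPf ji) mulr0.
Qed.

Lemma sqform_dot x : sqform x = dot x x.
Proof. by apply: eq_bigr => i _; rewrite expr2. Qed.

Lemma sqformD x y : sqform (x + y) = sqform x + 2 * dot x y + sqform y.
Proof. by rewrite !sqform_dot !dotDr !dotDl (dotC y x); ring. Qed.

Lemma sqformZ c x : sqform (c *: x) = c ^+ 2 * sqform x.
Proof. by rewrite !sqform_dot dotZl dotZr; ring. Qed.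

Lemma cV_neq0P x : x != 0 -> exists i, x i 0 != 0.
Proof.
move=> x0; apply/existsP; rewrite -negb_forall; apply: contraNN x0 => /forallP x0.
by apply/eqP/matrixP => i j; rewrite ord1 mxE; apply/eqP.
Qed.

Lemma card_cV : #|{: 'cV[F]_d}| = (#|F| ^ d)%N.
Proof. by rewrite card_mx muln1. Qed.

(* Summing over all translates of each point along the line of direction [b]
   counts every point of [P] exactly [#|F|] times. *)
Lemma line_sum (R : numDomainType) b (f : 'cV[F]_d -> R) (P : pred 'cV[F]_d) (m : nat) :
    (forall y, 0 <= f y) -> (forall y t, f (y + t *: b) = f y) ->
    (forall y, f y != 0 -> (#|[set t | P (y + t *: b)%R]| <= m)%N) ->
  #|F|%:R * \sum_(y | P y) f y <= m%:R * \sum_y f y.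
Proof.
move=> f0 fb Pm.
have -> : #|F|%:R * \sum_(y | P y) f y = \sum_y \sum_(t | P (y + t *: b)) f y.
  rewrite (exchange_big_dep xpredT) //= mulr_natl -sumr_const.
  apply: eq_big => // t _.
  rewrite (reindex (fun y => y + t *: b)) /=.
    by apply: eq_bigr => y _; rewrite fb.
  by exists (fun y => y - t *: b) => y _; rewrite ?addrK ?subrK.
rewrite mulr_sumr; apply: ler_sum => y _.
have [->|fy] := eqVneq (f y) 0; first by rewrite big1 ?mulr0.
rewrite sumr_const mulr_natl; apply: ler_wpMn2l => //.
by apply: leq_trans (Pm _ fy); rewrite cardsE.
Qed.

(** The case of [line_sum] in which [f] is the indicator of [W]. *)
Lemma line_card b (W : {set 'cV[F]_d}) (P : pred 'cV[F]_d) (m : nat) :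
    (forall y t, (y + t *: b \in W) = (y \in W)) ->
    (forall y, y \in W -> (#|[set t | P (y + t *: b)%R]| <= m)%N) ->
  (#|F| * #|[set y in W | P y]| <= m * #|W|)%N.
Proof.
move=> Wb Pm; have := @line_sum rat b (fun y => (y \in W)%:R) P m.
have sumE (A : pred 'cV[F]_d) :
    \sum_(y | A y) (y \in W)%:R = #|[set y in W | A y]|%:R :> rat.
  rewrite -natr_sum -big_mkcondr sum1_card; congr (_%:R).
  by apply: eq_card => y; rewrite !inE andbC.
have -> : \sum_y (y \in W)%:R = #|W|%:R :> rat.
  by rewrite sumE; congr (_%:R); apply: eq_card => y; rewrite inE andbT.
rewrite sumE -!natrM ler_nat; apply=> [y|y t|y].
- exact: ler0n.
- by rewrite Wb.
- by rewrite pnatr_eq0 eqb0 negbK => /Pm.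
Qed.

End DotProduct.

(** * Roots of quadratics, and the characteristic *)

Section FiniteField.

Variable F : finFieldType.

Lemma card_quadratic_roots (al be ga : F) :
    (al != 0) || (be != 0) ->
  (#|[set t | (al * t ^+ 2 + be * t + ga)%R == 0%R]| <= 2)%N.
Proof.
move=> nz; set p := Poly [:: ga; be; al].
have p0 : p != 0.
  apply: contraTneq nz => p0; rewrite negb_or !negbK.
  have co i : p`_i = 0 by rewrite p0 coef0.
  by have := co 2%N; have := co 1%N; rewrite !coef_Poly /= => -> ->; rewrite eqxx.
rewrite cardE -ltnS; apply: leq_trans (size_Poly [:: ga; be; al]).
apply: max_poly_roots p0 _ (enum_uniq _).
apply/allP => t; rewrite mem_enum inE /root horner_Poly /= => /eqP rt.
by apply/eqP; rewrite -[RHS]rt; ring.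
Qed.

(** [delta_mx i 0] has norm 1, so [sqform] along the line is a monic quadratic in [t]. *)
Lemma card_line_sphere d (x : 'cV[F]_d) (i : 'I_d) (r : F) :
  (#|[set t | sqform (x + t *: delta_mx i 0)%R == r]| <= 2)%N.
Proof.
have -> : [set t | sqform (x + t *: delta_mx i 0)%R == r]
   = [set t | (1 * t ^+ 2 + 2 * x i 0 * t + (sqform x - r))%R == 0%R].
  apply/setP => t; rewrite !inE sqformD sqformZ dotZr dot_delta.
  rewrite (sqform_dot (delta_mx i 0)) dot_delta mxE !eqxx -subr_eq0.
  by congr (_ == _); rewrite mulr1n; ring.
by apply: card_quadratic_roots; rewrite oner_neq0.
Qed.

(** In characteristic 2 the additive group is an elementary abelian 2-group, hence of even order. *)
Lemma odd_card_2neq0 : odd #|F| -> 2 != 0 :> F.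
Proof.
move=> oF; apply: contraTneq oF => F2.
have pF : 2%N \in [pchar F] by rewrite inE /= F2 eqxx.
have := abelem_pgroup (fin_ring_pchar_abelem pF).
rewrite /pgroup cardsT => /p_natP[[|n] cF]; last by rewrite cF oddX.
by have := finNzRing_gt1 F; rewrite cF.
Qed.

End FiniteField.

(** * Orthogonal maps and the congruences between two simplices *)

Section OrthogonalGroup.

Variables (F : finFieldType) (d : nat).
Hypothesis oddF : odd #|F|.
Local Notation q := #|F|.
Local Notation O := (orthogonal_group F d).
Implicit Types (th : 'M[F]_d) (x y w : 'cV[F]_d).

Lemma ortho_unitmx th : th \in O -> th \in unitmx.
Proof. by rewrite inE => /andP[]. Qed.

Lemma ortho_sqform th x : th \in O -> sqform (th *m x) = sqform x.
Proof. by rewrite inE => /andP[_ /forallP/(_ x)/eqP]. Qed.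

(** Polarization: [sqform] determines [2 * dot], and 2 is invertible. *)
Lemma ortho_dot th x y : th \in O -> dot (th *m x) (th *m y) = dot x y.
Proof.
move=> Oth; have := ortho_sqform (x + y) Oth.
rewrite mulmxDr !sqformD !ortho_sqform // => /addIr/addrI.
exact/mulfI/odd_card_2neq0.
Qed.

Lemma ortho1 : 1%:M \in O.
Proof. by rewrite inE unitmx1; apply/forallP => x; rewrite mul1mx. Qed.

Lemma orthoM th1 th2 : th1 \in O -> th2 \in O -> th1 *m th2 \in O.
Proof.
move=> O1 O2; rewrite inE unitmx_mul !ortho_unitmx //=.
by apply/forallP => x; rewrite -mulmxA !ortho_sqform.
Qed.

Lemma orthoV th : th \in O -> invmx th \in O.
Proof.
move=> Oth; have Uth := ortho_unitmx Oth.
rewrite inE unitmx_inv Uth; apply/forallP => x.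
by rewrite -(ortho_sqform _ Oth) mulKVmx.
Qed.

Lemma card_ortho_gt0 : (0 < #|O|)%N.
Proof. by apply/card_gt0P; exists 1%:M; apply: ortho1. Qed.

Lemma sum_orthoMr (R : nmodType) (f : 'M[F]_d -> R) rho :
  rho \in O -> \sum_(th in O) f th = \sum_(th in O) f (th *m rho).
Proof.
move=> Orho; have Urho := ortho_unitmx Orho.
rewrite (reindex (mulmx^~ rho)) /=.
  apply: eq_bigl => th; apply/idP/idP => Oth; last exact: orthoM.
  by rewrite -(mulmxK Urho th) orthoM ?orthoV.
by exists (mulmx^~ (invmx rho)) => th _; rewrite ?mulmxK ?mulmxKV.
Qed.

(** * Pointwise stabilizers of the first columns of an invertible matrix *)

Section StabilizerChain.

Variable L : 'M[F]_d.
Hypothesis unitL : L \in unitmx.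

Let fixer (j : nat) :=
  [set th in O | [forall i : 'I_d, (i < j)%N ==> (th *m col i L == col i L)]].

Let perp (j : nat) :=
  [set w : 'cV[F]_d | [forall i : 'I_d, (i < j)%N ==> (dot (col i L) w == 0)]].

(** The basis dual to the columns of [L]: [dual j] lies in [perp j] but is transverse to
    [perp j.+1]. *)
Let dual (i : 'I_d) : 'cV[F]_d := col i (invmx L)^T.

Let dot_dual (i j : 'I_d) : dot (col i L) (dual j) = (i == j)%:R.
Proof.
have := congr1 (fun M : 'M[F]_d => M j i) (mulVmx unitL).
rewrite !mxE eq_sym => <-.
by apply: eq_bigr => m _; rewrite !mxE mulrC.
Qed.

Let perpS (j : 'I_d) : perp j.+1 = [set w in perp j | dot (col j L) w == 0].
Proof.
apply/setP => w; rewrite !inE; apply/forallP/andP => [H | [/forallP H0 H1] i].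
  split; last by have := H j; rewrite ltnSn.
  by apply/forallP => i; apply/implyP => ij; apply: (implyP (H i)); apply: ltnW.
apply/implyP; rewrite ltnS leq_eqVlt => /orP[/eqP/val_inj-> //|].
exact: (implyP (H0 i)).
Qed.

Let perpD (j : nat) w1 w2 t : w2 \in perp j ->
  (w1 + t *: w2 \in perp j) = (w1 \in perp j).
Proof.
rewrite !inE => /forallP H2; apply: eq_forallb => i.
by case: (ltnP i j) (H2 i) => //= _ /eqP; rewrite dotDr dotZr => ->; rewrite mulr0 addr0.
Qed.

Let dual_perp (j : 'I_d) : dual j \in perp j.
Proof.
rewrite inE; apply/forallP => i; apply/implyP => ij.
by rewrite dot_dual -val_eqE ltn_eqF.
Qed.

(** A line in direction [dual j] contains at most one point of [perp j.+1], so each step loses a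
    factor [q]. *)
Let card_perp (j : nat) : (j <= d)%N -> (q ^ j * #|perp j| <= q ^ d)%N.
Proof.
elim: j => [|j IHj] jd; first by rewrite mul1n -(card_cV F d) max_card.
apply: leq_trans (IHj (ltnW jd)).
rewrite expnSr -mulnA leq_mul2l (perpS (Ordinal jd)); apply/orP; right.
rewrite -[leqRHS]mul1n.
apply: (@line_card _ _ (dual (Ordinal jd))) => [w t|w _].
  by rewrite perpD ?dual_perp.
apply/card_le1_eqP => s t; rewrite !inE !dotDr !dotZr !dot_dual eqxx !mulr1.
by move=> /eqP E1 /eqP E2; have /addrI := etrans E1 (esym E2).
Qed.

(** With [l = col j L], the equation says [sqform (l + w) = sqform l]: these are the possible values
    of [th l - l] for [th] in [fixer j]. *)
Let displacements (j : 'I_d) :=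
  [set w in perp j | 2 * dot (col j L) w + sqform w == 0].

(* A polynomial [2 l.w + Q(w)] of degree at most 2 has few zeros; it is not
   constant on [perp j], as either [Q] or [l] is nonzero there. *)
Let card_displacements (j : 'I_d) :
  (q * #|displacements j| <= 2 * #|perp j|)%N.
Proof.
have [b bW /orP bnz] : exists2 b, b \in perp j &
    (sqform b != 0) || [forall w in perp j, sqform w == 0] && (dot (col j L) b != 0).
  have [W0|] := boolP [forall w in perp j, sqform w == 0].
    by exists (dual j); rewrite ?dual_perp // dot_dual eqxx oner_neq0 orbT.
  by rewrite negb_forall_in => /exists_inP[b bW nz]; exists b; rewrite ?nz.
apply: (@line_card _ _ b) => [w t|w wW]; first exact: perpD.
set be := 2 * (dot (col j L) b + dot w b).
have -> : [set t | (2 * dot (col j L) (w + t *: b)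
                    + sqform (w + t *: b))%R == 0%R]
        = [set t | (sqform b * t ^+ 2 + be * t
                    + (2 * dot (col j L) w + sqform w))%R == 0%R].
  apply/setP => t; rewrite !inE sqformD sqformZ dotDr !dotZr /be.
  by congr (_ == _); ring.
apply: card_quadratic_roots; apply/orP; case: bnz => [|/andP[/forall_inP W0 lb]].
  by left.
right; rewrite /be mulf_neq0 ?odd_card_2neq0 //.
(* If [sqform] vanishes on [perp j], its value at [w + b] forces [dot w b = 0], and [be] reduces to
   [2 * dot l b]. *)
have /eqP := W0 (w + 1 *: b) (etrans (perpD _ _ bW) wW).
rewrite scale1r sqformD (eqP (W0 w wW)) (eqP (W0 b bW)) add0r addr0 => /eqP.
by rewrite mulf_eq0 (negPf (odd_card_2neq0 oddF)) /= => /eqP->; rewrite addr0.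
Qed.

Let fixerP (j : nat) th :
  reflect (th \in O /\ forall i : 'I_d, (i < j)%N -> th *m col i L = col i L)
          (th \in fixer j).
Proof.
apply: (iffP setIdP) => -[Oth]; first move=> /forallP H.
  by split=> // i ij; apply/eqP/(implyP (H i)).
by move=> H; split=> //; apply/forallP => i; apply/implyP => /H->.
Qed.

Let fixerS (j : 'I_d) :
  fixer j.+1 = [set th in fixer j | th *m col j L == col j L].
Proof.
apply/setP => th; apply/fixerP/setIdP => [[Oth fx] | [/fixerP[Oth fx] /eqP fxj]].
  split; last by rewrite fx.
  by apply/fixerP; split=> // i ij; apply/fx/ltnW.
split=> // i; rewrite ltnS leq_eqVlt => /orP[/eqP/val_inj-> //|].
exact: fx.
Qed.

Let fixer_displacement (j : 'I_d) th :
  th \in fixer j -> th *m col j L - col j L \in displacements j.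
Proof.
case/fixerP=> Oth fx; rewrite inE; apply/andP; split.
  rewrite inE; apply/forallP => i; apply/implyP => ij.
  by rewrite dotBr -{1}(fx i ij) ortho_dot // subrr.
have := ortho_sqform (col j L) Oth; rewrite -{1}(subrK (col j L) (th *m col j L)).
rewrite sqformD dotC => /(congr1 (fun c => c - sqform (col j L))).
by rewrite addrK subrr addrC => ->.
Qed.

(** Orbit counting: [th |-> th l - l] sends [fixer j] into [displacements j], and left translation
    embeds each fibre into [fixer j.+1]. *)
Let card_fixer_step (j : 'I_d) :
  (q ^ j.+1 * #|fixer j| <= 2 * q ^ d * #|fixer j.+1|)%N.
Proof.
have le1 : (#|fixer j| <= #|displacements j| * #|fixer j.+1|)%N.
  rewrite -sum1_card (partition_big (fun th => th *m col j L - col j L)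
    (mem (displacements j))) /=; last exact: fixer_displacement.
  rewrite -sum_nat_const; apply: leq_sum => w _; rewrite sum1_card.
  have [th0|e] := pickP [pred th in fixer j | th *m col j L - col j L == w]; last first.
    by rewrite eq_card0.
  move=> /andP[/fixerP[O0 fx0] /eqP e0].
  rewrite -(card_in_imset (f := mulmx (invmx th0))) => [|th1 th2 _ _ /(congr1 (mulmx th0))].
    apply: subset_leq_card; apply/subsetP => _ /imsetP[th /andP[/fixerP[Oth fx] /eqP e] ->].
    rewrite fixerS inE; apply/andP; split; last first.
      apply/eqP; rewrite -mulmxA; have /addIr -> := etrans e (esym e0).
      by rewrite mulKmx ?ortho_unitmx.
    apply/fixerP; split=> [|i ij]; first by rewrite orthoM ?orthoV.
    by rewrite -mulmxA fx // -{1}(fx0 i ij) mulKmx ?ortho_unitmx.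
  by rewrite !mulKVmx ?ortho_unitmx.
have le2 := card_displacements j; have le3 := card_perp (ltnW (ltn_ord j)).
apply: leq_trans (leq_mul (leqnn _) le1) _; rewrite mulnA leq_mul2r.
apply/orP; right; rewrite expnSr -mulnA.
by apply: leq_trans (leq_mul (leqnn _) le2) _; rewrite mulnCA leq_mul2l le3.
Qed.

(** Multiplying the steps for [j < k] gives [q] the exponent [1 + ... + k]. *)
Lemma card_ortho_fixer k : (k <= d)%N ->
  (q ^ 'C(k.+1, 2) * #|O|
   <= (2 * q ^ d) ^ k
      * #|[set th in O | [forall i : 'I_d, (i < k)%N ==> (th *m col i L == col i L)]]|)%N.
Proof.
rewrite -/(fixer k); elim: k => [|k IHk] kd.
  rewrite bin_small // !mul1n; apply: subset_leq_card; apply/subsetP => th Oth.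
  by apply/fixerP.
have := IHk (ltnW kd); have := card_fixer_step (Ordinal kd) => /=.
move=> H1 H2; rewrite binS bin1 expnD (expnSr (2 * _)) mulnAC mulnC -[leqRHS]mulnA.
apply: leq_trans (leq_mul (leqnn (q ^ k.+1)%N) H2) _.
by rewrite mulnCA leq_mul2l H1 orbT.
Qed.

End StabilizerChain.

Definition congruences k (x y : simplex F d k) : {set 'M[F]_d * 'cV[F]_d} :=
  [set g | (g.1 \in O) && [forall i, g.2 + g.1 *m x i == y i]].

(* The pointwise stabilizer of the edge vectors of [x] contains the fixer of [k]
   columns of an invertible matrix spanning them, even if [x] is degenerate. *)
Lemma card_congruences k (x y : simplex F d k) : (k <= d)%N -> congruent x y ->
  (q ^ 'C(k.+1, 2) * #|O| <= (2 * q ^ d) ^ k * #|congruences x y|)%N.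
Proof.
move=> kd /congruentP[th0 [z0 [O0 xy]]].
(* The columns of [U] are the edges from vertex 0. As [U] has rank at most [k], they lie in the span
   of the first [k] columns of [L]. *)
pose U := \matrix_(i < d, j < k) (x (lift ord0 j) - x ord0) i 0.
pose L := col_ebase U.
apply: leq_trans (card_ortho_fixer (col_ebase_unit U) kd) _.
rewrite leq_mul2l -/L; apply/orP; right.
(* The given congruence is preceded by the linear part [th]; the translation is then forced by
   sending vertex 0 to [y ord0]. *)
pose f th := (th0 *m th, y ord0 - th0 *m th *m x ord0).
rewrite -(card_imset _ (_ : injective f)) => [|th1 th2 [/(congr1 (mulmx (invmx th0)))]]; last first.
  by rewrite !mulKmx ?ortho_unitmx.
apply: subset_leq_card; apply/subsetP => _ /imsetP[th /setIdP[Oth /forallP fx] ->].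
rewrite inE orthoM //=; apply/forallP => i.
have [j ->|->] := unliftP ord0 i; last by rewrite subrK.
have fxU : th *m (x (lift ord0 j) - x ord0) = x (lift ord0 j) - x ord0.
  have -> : x (lift ord0 j) - x ord0 = col j U.
    by apply/matrixP => a b; rewrite !mxE ord1.
  rewrite -[U]mulmx_ebase -mulmxA -/L; set N := _ *m row_ebase U.
  have -> : col j (L *m N) = \sum_i N i j *: col i L.
    apply/matrixP => a b; rewrite summxE !mxE; apply: eq_bigr => i0 _.
    by rewrite !mxE mulrC.
  rewrite mulmx_sumr; apply: eq_bigr => i0 _; rewrite -scalemxAr.
  have [ik|ki] := ltnP i0 k; first by rewrite (eqP (implyP (fx i0) ik)).
  (* The rank normal form of [U] has zero rows from index [\rank U <= k] on. *)
  suff -> : N i0 j = 0 by rewrite !scale0r.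
  rewrite mxE big1 // => m _; rewrite mxE ltnNge.
  by rewrite (leq_trans (rank_leq_col U) ki) andbF mul0r.
have -> : y ord0 - th0 *m th *m x ord0 + th0 *m th *m x (lift ord0 j)
   = y ord0 + th0 *m (th *m (x (lift ord0 j) - x ord0)).
  by rewrite mulmxA mulmxBr addrAC addrA.
by rewrite fxU mulmxBr -!xy addrA addrAC addrK.
Qed.

End OrthogonalGroup.

(** * Additive characters and the Fourier transform *)

Lemma nontrivial_additive_character (F : finFieldType) :
  exists chi : F -> algC,
    [/\ forall a b, chi (a + b) = chi a * chi b, forall a, `|chi a| = 1
      & exists a, chi a != 1].
Proof.
pose G := [set: F]%G.
have abG : abelian G by apply: FinRing.zmod_abelian.
have NG : Nirr G = #|F| by rewrite NirrE (eqP (etrans (esym (card_classes_abelian G)) abG)) cardsT.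
(* The additive group is abelian, so it has [q > 1] irreducible characters, all linear; index 0 is
   the trivial one, hence the choice of index 1. *)
have N1 : (1 < Nirr G)%N by rewrite NG finNzRing_gt1.
pose i : Iirr G := Ordinal N1.
have lin : 'chi_i \is a linear_char by apply/char_abelianP.
exists 'chi_i; split=> [a b|a|].
- by rewrite -lin_charM ?inE.
- by rewrite normC_lin_char ?inE.
apply/existsP; rewrite -negb_forall; apply/negP => /forallP chi1.
suff /eqP : 'chi_i = 1 by rewrite irr_eq1.
by apply/cfunP => a; rewrite cfun1E inE; apply/eqP.
Qed.

Section Fourier.

Variables (F : finFieldType) (chi : F -> algC).
Hypothesis chiD : forall a b, chi (a + b) = chi a * chi b.
Hypothesis chi_norm : forall a, `|chi a| = 1.
Hypothesis chi_nontriv : exists a, chi a != 1.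
Local Notation q := #|F|.

Lemma chi_neq0 a : chi a != 0.
Proof. by rewrite -normr_eq0 chi_norm oner_neq0. Qed.

Lemma chi0 : chi 0 = 1.
Proof. by apply: (mulfI (chi_neq0 0)); rewrite -chiD addr0 mulr1. Qed.

Lemma chiN a : chi (- a) = (chi a)^*.
Proof.
apply: (mulfI (chi_neq0 a)); rewrite -chiD subrr chi0.
by rewrite -normCK chi_norm expr1n.
Qed.

Lemma chi_sum (I : Type) (r : seq I) (P : pred I) (f : I -> F) :
  chi (\sum_(i <- r | P i) f i) = \prod_(i <- r | P i) chi (f i).
Proof. exact: (big_morph chi chiD chi0). Qed.

(** For [x != 0], translating by some [b] with [chi (dot b x) != 1] multiplies the sum by that
    value, so the sum vanishes. *)
Lemma sum_char_dot d (x : 'cV[F]_d) :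
  \sum_xi chi (dot xi x) = (q ^ d * (x == 0))%:R.
Proof.
have [-> | x0] := eqVneq x 0.
  rewrite muln1 -(card_cV F d) -sum1_card natr_sum; apply: eq_bigr => xi _.
  by rewrite dotC dot0l chi0.
rewrite muln0; have [a chia] := chi_nontriv.
have [i xi0] := cV_neq0P x0.
pose b : 'cV[F]_d := (a / x i 0) *: delta_mx i 0.
have dotb : dot b x = a by rewrite dotZl dotC dot_delta divfK.
set s := \sum_xi _; apply/eqP; have : s = chi a * s.
  rewrite {1}/s (reindex (fun y => b + y)) /=.
    by rewrite mulr_sumr; apply: eq_bigr => y _; rewrite dotDl chiD dotb.
  by exists (fun y => y - b) => y _; [rewrite addrAC subrr add0r | rewrite addrC subrK].
move/eqP; rewrite -subr_eq0 -{1}[s]mul1r -mulrBl mulf_eq0 subr_eq0 eq_sym.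
by rewrite (negPf chia).
Qed.

Lemma sum_char (y : F) : \sum_s chi (s * y) = (q * (y == 0))%:R.
Proof.
have := @sum_char_dot 1 (const_mx y); rewrite expn1.
have -> : (const_mx y == 0 :> 'cV[F]_1) = (y == 0).
  apply/eqP/eqP => [/matrixP/(_ 0 0)|->]; first by rewrite !mxE.
  by apply/matrixP => i j; rewrite !mxE.
move<-; rewrite (reindex (fun s => const_mx s : 'cV[F]_1)) /=.
  by apply: eq_bigr => s _; rewrite /dot big_ord1 !mxE.
by exists (fun v : 'cV[F]_1 => v 0 0) => v _; rewrite ?mxE //; apply/matrixP => i j; rewrite !ord1 mxE.
Qed.

(** This is [|E^(xi)|^2] for the unnormalized transform of the indicator of [E]. *)
Definition spec d (E : {set 'cV[F]_d}) (xi : 'cV[F]_d) : algC :=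
  `|\sum_(u in E) chi (dot xi u)| ^+ 2.

Lemma spec_ge0 d (E : {set 'cV[F]_d}) xi : 0 <= spec E xi.
Proof. exact: exprn_ge0. Qed.

Lemma spec0 d (E : {set 'cV[F]_d}) : spec E 0 = (#|E| ^ 2)%:R.
Proof.
rewrite /spec (eq_bigr (fun=> 1)) => [|u _]; last by rewrite dot0l chi0.
by rewrite sumr_const normr_nat natrX.
Qed.

(** After expanding the square, orthogonality of characters leaves only the terms [u = v]. *)
Lemma plancherel d (f : 'cV[F]_d -> algC) :
  \sum_xi `|\sum_u f u * chi (dot xi u)| ^+ 2 = (q ^ d)%:R * \sum_u `|f u| ^+ 2.
Proof.
have sqE xi : `|\sum_u f u * chi (dot xi u)| ^+ 2
    = \sum_u \sum_v f u * (f v)^* * chi (dot xi (u - v)).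
  rewrite normCK rmorph_sum mulr_suml; apply: eq_bigr => u _.
  rewrite mulr_sumr; apply: eq_bigr => v _.
  by rewrite rmorphM dotBr chiD chiN /=; ring.
rewrite (eq_bigr _ (fun xi _ => sqE xi)) exchange_big mulr_sumr /=.
apply: eq_bigr => u _.
have cst v : \sum_xi f u * (f v)^* * chi (dot xi (u - v))
    = f u * (f v)^* * (q ^ d * (u == v))%:R.
  by rewrite -mulr_sumr sum_char_dot subr_eq0.
rewrite exchange_big (eq_bigr _ (fun v _ => cst v)) (bigD1 u) //=.
rewrite [X in _ + X]big1 ?addr0 => [|v vu].
  by rewrite eqxx muln1 normCK mulrC.
by rewrite eq_sym (negPf vu) muln0 mulr0.
Qed.

Lemma sum_spec d (E : {set 'cV[F]_d}) : \sum_xi spec E xi = (q ^ d * #|E|)%:R.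
Proof.
have specE xi : spec E xi = `|\sum_u (u \in E)%:R * chi (dot xi u)| ^+ 2.
  by rewrite /spec big_mkcond; congr (`|_| ^+ 2); apply: eq_bigr => u _;
     case: ifP => _; rewrite ?mul1r ?mul0r.
rewrite (eq_bigr _ (fun xi _ => specE xi)) plancherel natrM -sum1_card natr_sum.
rewrite [X in _ = _ * X]big_mkcond; congr (_ * _); apply: eq_bigr => u _.
by case: ifP => _; rewrite ?normr1 ?normr0 ?expr1n ?expr0n.
Qed.

Definition spec1 (A : {set F}) (s : F) : algC := `|\sum_(a in A) chi (s * a)| ^+ 2.

Lemma sum_spec1 (A : {set F}) : \sum_s spec1 A s = (q * #|A|)%:R.
Proof.
have E s : spec1 A s = \sum_(u in A) \sum_(v in A) chi (s * (u - v)).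
  rewrite /spec1 normCK rmorph_sum mulr_suml; apply: eq_bigr => u _.
  rewrite mulr_sumr; apply: eq_bigr => v _.
  by rewrite mulrBr chiD chiN.
rewrite (eq_bigr _ (fun s _ => E s)) exchange_big /=.
rewrite -(sum1_card (mem A)) natrM natr_sum mulr_sumr; apply: eq_bigr => u uA.
rewrite exchange_big (bigD1 u) //= [X in _ + X]big1 ?addr0 => [|v /andP[vA vu]].
  by rewrite sum_char subrr eqxx natrM.
by rewrite sum_char subr_eq0 eq_sym (negPf vu) muln0.
Qed.

Lemma spec1_le (A : {set F}) s : spec1 A s <= (#|A| ^ 2)%:R.
Proof.
rewrite natrX ler_pXn2r ?nnegrE //.
rewrite -sum1_card natr_sum (le_trans (ler_norm_sum _ _ _)) //.
by rewrite ler_sum // => a _; rewrite chi_norm.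
Qed.

Variable d : nat.

Lemma big_cV_distr (R : comPzSemiRingType) (P : 'I_d -> pred F) (f : 'I_d -> F -> R) :
  \sum_(u : 'cV[F]_d | [forall i, P i (u i 0)]) \prod_i f i (u i 0)
    = \prod_i \sum_(s | P i s) f i s.
Proof.
rewrite bigA_distr_big_dep (reindex (fun g : {ffun 'I_d -> F} => \col_i g i)) /=.
  apply: eq_big => [g|g _]; last by apply: eq_bigr => i _; rewrite mxE.
  by apply/forallP/familyP => H i; have := H i; rewrite mxE.
exists (fun u : 'cV[F]_d => [ffun i => u i 0]) => u _.
  by apply/ffunP => i; rewrite ffunE mxE.
by apply/matrixP => i j; rewrite ord1 mxE ffunE.
Qed.

Variable A : 'I_d -> {set F}.
Local Notation E := (cartesian A).

Lemma card_cartesian : #|E| = (\prod_i #|A i|)%N.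
Proof.
apply/eqP; rewrite -(eqr_nat rat) natr_prod; apply/eqP.
have := @big_cV_distr rat (fun i s => s \in A i) (fun _ _ => 1).
rewrite big1_eq sumr_const => H.
rewrite (eq_bigr (fun i => \sum_(s in A i) 1)) => [|i _]; last by rewrite sumr_const.
by rewrite -[RHS]H; congr (_%:R); apply: eq_card => u; rewrite inE.
Qed.

(** [chi] turns the dot product into a product over coordinates, so the transform of a box
    factors. *)
Lemma spec_cartesian xi : spec E xi = \prod_i spec1 (A i) (xi i 0).
Proof.
rewrite /spec /spec1 prodrXl -normr_prod -big_cV_distr; congr (`|_| ^+ 2).
apply: eq_big => [u|u _]; first by rewrite inE.
by rewrite chi_sum.
Qed.

(* Bound the [i]-th factor of the transform by [#|A i|]: the majorant no longer
   depends on the [i]-th coordinate, and a line in that direction meets a sphere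
   at most twice. *)
Lemma sum_spec_sphere (i : 'I_d) t :
  q%:R * \sum_(eta | sqform eta == t) spec E eta
    <= (2 * (q ^ d * (#|A i| * #|E|)))%:R.
Proof.
pose g (eta : 'cV[F]_d) : algC :=
  \prod_j if j == i then (#|A i| ^ 2)%:R else spec1 (A j) (eta j 0).
(* Coordinate [i] contributes [q * #|A i| ^ 2], and every other [j] contributes [q * #|A j|] by
   [sum_spec1]. *)
have gE : \sum_eta g eta = (q ^ d * (#|A i| * #|E|))%:R.
  have := @big_cV_distr algC (fun _ _ => true)
    (fun j s => if j == i then (#|A i| ^ 2)%:R else spec1 (A j) s).
  move=> H; transitivity (\sum_(u : 'cV[F]_d | [forall j : 'I_d, true]) g u).
    by apply: eq_bigl => u; symmetry; apply/(@forallP _ xpredT).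
  rewrite [LHS]H (bigD1 i) //= eqxx sumr_const.
  rewrite (eq_bigr (fun j => (q * #|A j|)%:R)) => [|j /negPf->]; last exact: sum_spec1.
  rewrite -natr_prod card_cartesian [in RHS](bigD1 i) //= big_split /=.
  rewrite prod_nat_const (eq_card (B := predC1 i)) // cardC1 card_ord.
  rewrite -mulrnA -natrM; congr (_%:R).
  have qd : (q ^ d = q * q ^ d.-1)%N.
    by rewrite -expnS prednK // (leq_ltn_trans _ (ltn_ord i)).
  have -> : #|(xpredT : pred F)| = q by apply: eq_card.
  by rewrite qd -mulnn; lia.
rewrite natrM -gE.
apply: le_trans (_ : q%:R * \sum_(eta | sqform eta == t) g eta <= _).
  rewrite ler_wpM2l ?ler0n // ler_sum // => eta _.
  rewrite spec_cartesian ler_prod // => j _; rewrite exprn_ge0 //=.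
  by case: eqP => [->|_]; rewrite ?spec1_le.
apply: (@line_sum F d algC (delta_mx i 0) g _ 2) => [eta|eta s|eta _].
- apply: prodr_ge0 => j _; case: ifP => _; first exact: ler0n.
  exact: exprn_ge0.
- apply: eq_bigr => j _; case: eqP => // /eqP/negPf ji.
  by rewrite !mxE ji mulr0 addr0.
- exact: card_line_sphere.
Qed.

End Fourier.

(** * Reflections and averages over the orthogonal group *)

Section Reflections.

Variables (F : finFieldType) (d : nat).
Hypothesis oddF : odd #|F|.
Local Notation q := #|F|.
Local Notation O := (orthogonal_group F d).
Implicit Types (th : 'M[F]_d) (x w xi : 'cV[F]_d).

(** The reflection in the hyperplane orthogonal to [w]; for [sqform w = 0] it degenerates to the
    identity, since [0^-1 = 0]. *)
Definition reflection w : 'M[F]_d := 1%:M - (2 / sqform w) *: (w *m w^T).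

Lemma reflectionE w x : reflection w *m x = x - (2 / sqform w * dot w x) *: w.
Proof.
rewrite mulmxBl mul1mx -scalemxAl -mulmxA -scalerA; congr (_ - _ *: _).
have -> : w^T *m x = (dot w x)%:M.
  apply/matrixP => i j; rewrite !ord1 !mxE mulr1n.
  by apply: eq_bigr => m _; rewrite mxE.
by rewrite mul_mx_scalar.
Qed.

Lemma reflectionK w : sqform w != 0 -> involutive (mulmx (reflection w) : 'cV[F]_d -> _).
Proof.
move=> w0 x; rewrite !reflectionE dotBr dotZr -sqform_dot.
set c := 2 / _ * dot w x; suff -> : 2 / sqform w * (dot w x - c * sqform w) = - c.
  by rewrite scaleNr opprK subrK.
by rewrite /c; field.
Qed.

Lemma ortho_reflection w : sqform w != 0 -> reflection w \in O.
Proof.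
move=> w0; rewrite inE; apply/andP; split; last first.
  apply/forallP => x; rewrite reflectionE -scaleNr sqformD sqformZ dotZr (dotC x).
  by apply/eqP; field.
have /mulmx1_unit[] // : reflection w *m reflection w = 1%:M.
apply/matrixP => i j; have /matrixP/(_ i 0) := reflectionK w0 (delta_mx j 0).
by rewrite mulmxA -colE -[in X in _ = X -> _](mul1mx (delta_mx j 0)) -colE !mxE.
Qed.

(** The first condition makes [reflection w] a genuine reflection, the second makes it move [xi]. *)
Definition reflectors xi := [set w | (sqform w != 0) && (dot xi w != 0)].

(** At most [2 q^(d-1)] vectors are isotropic and at most [q^(d-1)] are orthogonal to [xi]; what
    remains has proportion at least [1 - 3/q >= 2/5]. *)
Lemma card_reflectors xi : xi != 0 -> (5 <= q)%N ->
  (2 * q ^ d <= 5 * #|reflectors xi|)%N.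
Proof.
move=> xi0 q5.
have [i xii] := cV_neq0P xi0.
pose b : 'cV[F]_d := delta_mx i 0.
have : (q * #|[set w : 'cV[F]_d in setT | sqform w == 0%R]| <= 2 * #|[set: 'cV[F]_d]|)%N.
  apply: (@line_card _ _ b) => [w t|w _]; first by rewrite !inE.
  exact: card_line_sphere.
have : (q * #|[set w : 'cV[F]_d in setT | dot xi w == 0%R]| <= 1 * #|[set: 'cV[F]_d]|)%N.
  apply: (@line_card _ _ b) => [w t|w _]; first by rewrite !inE.
  apply/card_le1_eqP => s t; rewrite !inE !dotDr !dotZr !dot_delta => /eqP E1 /eqP E2.
  by have /addrI/(mulIf xii) := etrans E1 (esym E2).
rewrite cardsT card_cV.
set B1 := [set w in _ | _]; set B2 := [set w in _ | _]; rewrite /reflectors; set W := [set w | _].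
have : (q ^ d <= #|W| + #|B1| + #|B2|)%N.
  rewrite -(card_cV F d) -cardsT.
  apply: leq_trans (leq_add (leq_card_setU W B1).1 (leqnn _)).
  apply: leq_trans (leq_card_setU _ _).1; apply: subset_leq_card.
  by apply/subsetP => w _; rewrite !inE; do 2!case: eqP.
nia.
Qed.

(* Each point [th xi] is replaced by the average of [th r_w xi] over reflections
   [r_w]; these points lie on one sphere and each is hit by at most [q] vectors
   [w], which all lie on a line. *)
Lemma sum_ortho_le (R : numDomainType) (f : 'cV[F]_d -> R) (B : R) xi :
    (5 <= q)%N -> xi != 0 -> (forall eta, 0 <= f eta) ->
    (forall t, q%:R * \sum_(eta | sqform eta == t) f eta <= B) ->
  2 * (q ^ d)%:R * \sum_(th in O) f (th *m xi) <= 5 * #|O|%:R * B.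
Proof.
move=> q5 xi0 f0 fB; have := card_reflectors xi0 q5.
set W := reflectors xi => cW; set S := \sum_(th in O) _.
have S0 : 0 <= S by rewrite sumr_ge0.
have B1 th : th \in O -> \sum_(w in W) f (th *m reflection w *m xi) <= B.
  move=> Oth; apply: le_trans (fB (sqform xi)).
  rewrite (partition_big (fun w => th *m reflection w *m xi)
             (fun eta => sqform eta == sqform xi)) /=; last first.
    move=> w /[!inE] /andP[w0 _].
    by rewrite ortho_sqform // orthoM // ortho_reflection.
  rewrite mulr_sumr; apply: ler_sum => eta _.
  rewrite (eq_bigr (fun=> f eta)) => [|w /andP[_ /eqP->] //].
  rewrite sumr_const mulr_natl; apply: ler_wpMn2l => //.
  have [w0|e] := pickP [pred w in W | th *m reflection w *m xi == eta]; last first.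
    by rewrite eq_card0.
  case/andP=> /[!inE] /andP[w00 xw0] /eqP e0.
  rewrite -cardsT; apply: leq_trans (leq_imset_card (fun c : F => c *: w0) _).
  apply: subset_leq_card; apply/subsetP => w /andP[] /[!inE] /andP[w1 xw1] /eqP e1.
  have : reflection w *m xi = reflection w0 *m xi.
    by apply: (can_inj (mulKmx (ortho_unitmx Oth))); rewrite !mulmxA e0 e1.
  (* [xi - r_w xi] is a nonzero multiple of [w], so equal images make [w] proportional to [w0]. *)
  rewrite !reflectionE => /addrI/oppr_inj.
  set c := (X in X *: w = _); set c0 := (X in _ = X *: w0) => ec.
  have cn : c != 0.
    by rewrite !mulf_neq0 ?invr_eq0 ?odd_card_2neq0 // dotC.
  by apply/imsetP; exists (c^-1 * c0); rewrite ?inE // -scalerA -ec scalerK.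
have WS : #|W|%:R * S <= #|O|%:R * B.
  (* Right multiplication by a reflection permutes [O], so every inner sum equals [S]. *)
  have -> : #|W|%:R * S = \sum_(w in W) \sum_(th in O) f (th *m reflection w *m xi).
    rewrite mulr_natl -sumr_const; apply: eq_bigr => w /[!inE] /andP[w0 _].
    by rewrite /S (sum_orthoMr _ (ortho_reflection w0)).
  rewrite exchange_big /= mulr_natl -sumr_const; exact: ler_sum.
rewrite -mulrA; apply: le_trans (_ : 5 * (#|W|%:R * S) <= _); last first.
  by rewrite -mulrA ler_wpM2l.
by rewrite !mulrA ler_wpM2r // -!natrM ler_nat.
Qed.

End Reflections.

Lemma sum_indicator (T : finType) (U : nmodType) (B : {set T}) (f : T -> U) :
  \sum_x f x *+ (x \in B) = \sum_(x in B) f x.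
Proof. by rewrite [RHS]big_mkcond; apply: eq_bigr => x _; case: ifP. Qed.

(** * The second moment of the overlap counts *)

Section SecondMoment.

Variables (F : finFieldType) (d : nat).
Hypothesis oddF : odd #|F|.
Local Notation q := #|F|.
Local Notation O := (orthogonal_group F d).

Definition overlap (E : {set 'cV[F]_d}) (th : 'M[F]_d) (z : 'cV[F]_d) : nat :=
  #|[set v in E | z + th *m v \in E]|.

(** A point [v] counted by [overlap E th z] is a pair [(v, u)] of points of [E] with
    [z = u - th v]. *)
Lemma sum_overlap (U : nmodType) E th (f : 'cV[F]_d -> U) :
  \sum_z f z *+ overlap E th z = \sum_(v in E) \sum_(u in E) f (u - th *m v).
Proof.
have term v : \sum_(u in E) f (u - th *m v) = \sum_z f z *+ (z + th *m v \in E).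
  rewrite -sum_indicator (reindex (fun z => z + th *m v)) /=.
    by apply: eq_bigr => z _; rewrite addrK.
  by exists (fun z => z - th *m v) => z _; rewrite ?addrK ?subrK.
rewrite (eq_bigr _ (fun v _ => term v)) exchange_big /=; apply: eq_bigr => z _.
rewrite GRing.sumrMnr /overlap -sum1_card big_mkcond [in RHS]big_mkcond /=.
by congr (_ *+ _); apply: eq_bigr => v _; rewrite inE; do 2!case: (_ \in _).
Qed.

Lemma sum_overlap_card (E : {set 'cV[F]_d}) th : (\sum_z overlap E th z = #|E| ^ 2)%N.
Proof.
apply/eqP; rewrite -(eqr_nat rat) natr_sum (sum_overlap E th (fun=> 1 : rat)).
rewrite (eq_bigr (fun=> #|E|%:R)) => [|v _]; last by rewrite sumr_const.
by rewrite sumr_const -mulrnA mulnn.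
Qed.

Variable chi : F -> algC.
Hypothesis chiD : forall a b, chi (a + b) = chi a * chi b.
Hypothesis chi_norm : forall a, `|chi a| = 1.
Hypothesis chi_nontriv : exists a, chi a != 1.

(** Plancherel for [overlap E th]: as [th] preserves [dot], the transform at [th xi] is [E^(th xi)]
    times the conjugate of [E^(xi)]. *)
Lemma overlap_energy (E : {set 'cV[F]_d}) th : th \in O ->
  (q ^ d * \sum_z overlap E th z ^ 2)%:R
    = \sum_xi spec chi E xi * spec chi E (th *m xi).
Proof.
move=> Oth; rewrite natrM natr_sum.
have nrm z : (overlap E th z ^ 2)%:R = `|(overlap E th z)%:R : algC| ^+ 2.
  by rewrite normr_nat natrX.
rewrite (eq_bigr _ (fun z _ => nrm z)) -(plancherel chiD chi_norm chi_nontriv).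
have Uth := ortho_unitmx Oth.
rewrite (reindex (mulmx th)) /=; last first.
  by exists (mulmx (invmx th)) => x _; rewrite ?mulKmx ?mulKVmx.
apply: eq_bigr => xi _.
under eq_bigr do rewrite mulr_natl.
rewrite (sum_overlap E th (fun z => chi (dot (th *m xi) z))).
rewrite /spec -exprMn mulrC -(norm_conjC (\sum_(u in E) chi (dot xi u))) -normrM.
rewrite rmorph_sum mulr_sumr; congr (`|_| ^+ 2); apply: eq_bigr => v _.
rewrite mulr_suml; apply: eq_bigr => u _.
by rewrite dotBr (ortho_dot oddF _ _ Oth) chiD (chiN chiD chi_norm).
Qed.

(** Frequency 0 yields the term [#|E| ^ 4]; the other frequencies are bounded by [K] times the total
    mass of [spec]. *)
Lemma second_moment_chi (A : 'I_d -> {set F}) i : (5 <= q)%N ->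
  (q ^ d * \sum_(th in O) \sum_z overlap (cartesian A) th z ^ 2
   <= #|O| * (#|cartesian A| ^ 4
              + 5 * #|A i| * (q ^ d) * #|cartesian A| ^ 2))%N.
Proof.
move=> q5; set E := cartesian A; set S := spec chi E.
rewrite -(ler_nat algC) big_distrr natr_sum /=.
rewrite (eq_bigr _ (@overlap_energy E)) exchange_big /= (bigD1 0) //=.
(* [K] is [5 * #|O| * B / (2 q^d)] from [sum_ortho_le], with [B = 2 q^d #|A i| #|E|] from
   [sum_spec_sphere]. *)
pose K : algC := (5 * #|A i| * #|E| * #|O|)%:R.
have -> : (#|O| * (#|E| ^ 4 + 5 * #|A i| * q ^ d * #|E| ^ 2))%:R
    = (#|O| * #|E| ^ 4)%:R + K * (q ^ d * #|E|)%:R :> algC.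
  by rewrite /K -natrM -natrD; congr (_%:R); rewrite mulnDr -(mulnn #|E|); lia.
apply: lerD.
  rewrite (eq_bigr (fun=> (#|E| ^ 4)%:R)) => [|th _].
    by rewrite sumr_const -mulrnA mulnC.
  by rewrite mulmx0 (spec0 chiD chi_norm) -natrM -expnD.
rewrite -(sum_spec chiD chi_norm chi_nontriv) mulr_sumr [leRHS](bigD1 0) //=.
apply: ler_wpDl; first by rewrite mulr_ge0 ?ler0n ?spec_ge0.
apply: ler_sum => xi xi0; rewrite -mulr_sumr mulrC; apply: ler_wpM2r.
  exact: spec_ge0.
have sph := sum_spec_sphere chiD chi_norm chi_nontriv A i.
have := sum_ortho_le oddF q5 xi0 (spec_ge0 chi E) sph.
have qd0 : 0 < 2 * (q ^ d)%:R :> algC.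
  by rewrite -natrM ltr0n muln_gt0 expn_gt0 (leq_trans _ q5).
rewrite -(ler_pM2l qd0 _ K) => /le_trans; apply.
rewrite /K -!natrM ler_nat -/E; lia.
Qed.

End SecondMoment.

Lemma second_moment (F : finFieldType) d (A : 'I_d -> {set F}) i :
    odd #|F| -> (5 <= #|F|)%N ->
  (#|F| ^ d * \sum_(th in orthogonal_group F d) \sum_z overlap (cartesian A) th z ^ 2
   <= #|orthogonal_group F d|
      * (#|cartesian A| ^ 4 + 5 * #|A i| * (#|F| ^ d) * #|cartesian A| ^ 2))%N.
Proof.
move=> oF q5; have [chi [chiD chi_norm chi_nt]] := nontrivial_additive_character F.
exact: (second_moment_chi oF chiD chi_norm chi_nt).
Qed.

(* Either [nu] is at most twice the mean [mu], or [nu <= 2 (nu - mu)]. *)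
Lemma expr_le_centered (R : realFieldType) (nu mu e : R) k :
    0 <= nu <= e -> 0 <= mu ->
  nu ^+ k.+2 <= (2 * mu) ^+ k.+2 + 4 * e ^+ k * (nu - mu) ^+ 2.
Proof.
move=> /andP[nu0 nue] mu0; have e0 := le_trans nu0 nue.
have [nm|mn] := lerP nu (2 * mu).
  apply: ler_wpDr; first by rewrite mulr_ge0 ?sqr_ge0 ?mulr_ge0 ?exprn_ge0.
  by rewrite ler_pXn2r ?nnegrE // mulr_ge0.
apply: ler_wpDl; first by rewrite exprn_ge0 // mulr_ge0.
rewrite -addn2 exprD (mulrC 4) -mulrA ler_pM ?exprn_ge0 //.
  by apply: lerXn2r; rewrite ?nnegrE.
by nra.
Qed.

(** Cauchy-Schwarz, obtained by summing [2 n_i n_j <= n_i^2 + n_j^2] over all pairs. *)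
Lemma sqr_sum_le (I : finType) (D : {set I}) (n : I -> nat) :
  ((\sum_(i in D) n i) ^ 2 <= #|D| * \sum_(i in D) n i ^ 2)%N.
Proof.
rewrite -(leq_pmul2l (ltn0Sn 1)) -mulnn big_distrl big_distrr /=.
apply: leq_trans (_ : \sum_(i in D) \sum_(j in D) (n i ^ 2 + n j ^ 2) <= _)%N.
  apply: leq_sum => i _; rewrite !big_distrr /=; apply: leq_sum => j _.
  by have := (nat_Cauchy (n i) (n j)).1.
under eq_bigr do rewrite big_split sum_nat_const /=.
by rewrite big_split sum_nat_const -big_distrr /= addnn mul2n.
Qed.

(** * Congruent pairs of simplices and their congruences *)

Section Counting.

Variables (F : finFieldType) (d k : nat) (E : {set 'cV[F]_d}).
Hypothesis oddF : odd #|F|.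
Local Notation q := #|F|.
Local Notation O := (orthogonal_group F d).

Definition simplices : {set simplex F d k} :=
  [set x : simplex F d k | [forall i, x i \in E]].

Lemma in_simplices x : (x \in simplices) = [forall i, x i \in E].
Proof. by rewrite inE. Qed.

Lemma card_simplices : #|simplices| = (#|E| ^ k.+1)%N.
Proof.
rewrite -[k.+1 in RHS]card_ord -card_ffun_on; apply: eq_card => x.
by rewrite inE; apply/forallP/ffun_onP.
Qed.

(** Cauchy-Schwarz over the classes, applied to the number of simplices of [E] in each; two members
    of one class form a congruent pair. *)
Lemma sqr_card_simplices_le :
  (#|simplices| ^ 2 <= #|determined_classes k E|
     * \sum_(x in simplices) \sum_(y in simplices) congruent x y)%N.
Proof.
pose cls (x : simplex F d k) := [set y in [set: simplex F d k] | congruent x y].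
have clsD x : x \in simplices -> cls x \in determined_classes k E.
  rewrite !inE => xE; apply/andP; split; first by apply: imset_f.
  by apply/existsP; exists x; rewrite !inE congruent_refl.
rewrite -[X in (X ^ 2)%N]sum1_card (partition_big cls (mem (determined_classes k E))) //=.
apply: leq_trans (sqr_sum_le _ _) _; rewrite leq_mul2l; apply/orP; right.
rewrite [leqRHS](partition_big cls (mem (determined_classes k E))) //=.
apply: leq_sum => K _; rewrite -mulnn big_distrl; apply: leq_sum => x /andP[xE /eqP xK].
rewrite /= mul1n big_mkcond [leqRHS]big_mkcond /=; apply: leq_sum => y _.
case: (y \in simplices) => //=; case: eqP => // yK.
have : y \in cls x by rewrite xK -yK !inE congruent_refl.
by rewrite !inE /= => ->.
Qed.

(** Both sides count the triples [(th, z, x)] for which [x] and its image have all vertices in [E];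
    given [(th, z)], the [k.+1] vertices are chosen independently. *)
Lemma sum_congruences :
  (\sum_(x in simplices) \sum_(y in simplices) #|congruences x y|
   = \sum_(th in O) \sum_z overlap E th z ^ k.+1)%N.
Proof.
pose act (th : 'M[F]_d) z (x : simplex F d k) : simplex F d k := [ffun i => z + th *m x i].
have congE x y : #|congruences x y| = (\sum_(th in O) \sum_z (act th z x == y))%N.
  rewrite pair_big_dep /= -sum1_card big_mkcond [in RHS]big_mkcond /=.
  apply: eq_bigr => -[th z] _; rewrite inE /= andbT.
  case: (th \in O) => //=; rewrite (_ : [forall i, _] = (act th z x == y)); first by case: eqP.
  apply/forallP/eqP => [H|<- i]; last by rewrite ffunE.
  by apply/ffunP => i; rewrite ffunE (eqP (H i)).
have ovE th z : (overlap E th z ^ k.+1 = \sum_(x in simplices) (act th z x \in simplices))%N.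
  rewrite -[k.+1 in LHS]card_ord -card_ffun_on -sum1_card big_mkcond [RHS]big_mkcond /=.
  apply: eq_bigr => x _; rewrite !in_simplices.
  have -> : (x \in ffun_on [set v in E | z + th *m v \in E])
      = [forall i, x i \in E] && [forall i, act th z x i \in E].
    apply/ffun_onP/andP => [H|[/forallP H1 /forallP H2] i].
      by split; apply/forallP => i; have := H i; rewrite inE ?ffunE => /andP[].
    by have := H2 i; rewrite inE H1 ffunE.
  by case: [forall i, x i \in E]; case: [forall i, _].
under [RHS]eq_bigr do under eq_bigr do rewrite ovE.
under [RHS]eq_bigr do rewrite exchange_big /=.
rewrite [RHS]exchange_big /=; apply: eq_bigr => x _.
under eq_bigr do rewrite congE.
rewrite exchange_big /=; apply: eq_bigr => th _.
rewrite exchange_big /=; apply: eq_bigr => z _.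
have [aE|aE] := boolP (act th z x \in simplices).
  rewrite (bigD1 (act th z x)) //= eqxx big1 // => y /andP[_ ya].
  by rewrite eq_sym (negPf ya).
by rewrite big1 // => y yE; case: eqP => // ay; rewrite -ay (negPf aE) in yE.
Qed.

End Counting.

(** * From the variance to higher moments *)

Section Moments.

Variables (R : realFieldType) (F : finFieldType) (d : nat).
Variables (A : 'I_d -> {set F}) (i : 'I_d).
Hypothesis oddF : odd #|F|.
Hypothesis q5 : (5 <= #|F|)%N.
Local Notation Q := (#|F|%:R ^+ d : R).
Local Notation O := (orthogonal_group F d).
Local Notation E := (cartesian A).
Local Notation e := (#|cartesian A|%:R : R).
Local Notation mu := (e ^+ 2 / Q).

Let Q_gt0 : 0 < Q.
Proof. by rewrite exprn_gt0 // ltr0n (leq_trans _ q5). Qed.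

(** [mu] is the mean of the overlap over [z], so subtracting it removes exactly the main term of
    [second_moment]. *)
Lemma sum_deviation :
  \sum_(th in O) \sum_z ((overlap E th z)%:R - mu) ^+ 2
    <= #|O|%:R * (5 * #|A i|%:R * e ^+ 2).
Proof.
have dev th : \sum_z ((overlap E th z)%:R - mu) ^+ 2
    = (\sum_z overlap E th z ^ 2)%:R - e ^+ 4 / Q.
  transitivity (\sum_z ((overlap E th z ^ 2)%:R - (overlap E th z)%:R * (2 * mu) + mu ^+ 2)).
    by apply: eq_bigr => z _; rewrite natrX; ring.
  rewrite big_split sumrB -mulr_suml -!natr_sum sum_overlap_card sumr_const card_cV.
  by rewrite -(mulr_natr (_ ^+ 2)) !natrX /=; field; rewrite gt_eqF.
have := second_moment A i oddF q5; rewrite (eq_bigr _ (fun th _ => dev th)) sumrB sumr_const -natr_sum.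
set T := (\sum_(th in O) _)%N.
rewrite -(ler_nat R) !(natrM, natrD, natrX) -(mulr_natr (_ / _)) => H.
rewrite -(ler_pM2l Q_gt0) mulrBr lerBlDr.
apply: le_trans H _; rewrite le_eqVlt; apply/orP; left; apply/eqP.
by field; rewrite gt_eqF.
Qed.

(** [expr_le_centered] applies pointwise because the overlap is at most [e]; the hypothesis then
    absorbs the variance term. The 20 is its 4 times the 5 of [sum_deviation]. *)
Lemma high_moment k (C : R) : 0 < C ->
    C * #|A i|%:R * Q ^+ k.+1 <= e ^+ k.+2 ->
  Q ^+ k.+1 * (\sum_(th in O) \sum_z overlap E th z ^ k.+2)%:R
    <= #|O|%:R * (2 ^+ k.+2 + 20 / C) * (e ^+ k.+2) ^+ 2.
Proof.
move=> C0 hE.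
have mu0 : 0 <= mu by rewrite divr_ge0 ?exprn_ge0.
have H : (\sum_(th in O) \sum_z overlap E th z ^ k.+2)%:R
    <= #|O|%:R * (Q * (2 * mu) ^+ k.+2 + 20 * #|A i|%:R * e ^+ k.+2).
  have -> : #|O|%:R * (Q * (2 * mu) ^+ k.+2 + 20 * #|A i|%:R * e ^+ k.+2)
     = \sum_(th in O) \sum_(z : 'cV[F]_d) (2 * mu) ^+ k.+2
       + 4 * e ^+ k * (#|O|%:R * (5 * #|A i|%:R * e ^+ 2)).
    rewrite !sumr_const card_cV -mulrnA.
    by rewrite -(mulr_natr (_ ^+ _)) natrM natrX !(exprS e); ring.
  rewrite natr_sum; under eq_bigr do rewrite natr_sum.
  apply: le_trans (lerD (lexx _) (ler_wpM2l _ sum_deviation)); last first.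
    by rewrite mulr_ge0 ?exprn_ge0.
  rewrite mulr_sumr -big_split; apply: ler_sum => th _ /=.
  rewrite mulr_sumr -big_split; apply: ler_sum => z _ /=.
  rewrite natrX expr_le_centered // ler0n ler_nat.
  by apply: subset_leq_card; apply/subsetP => v; rewrite inE => /andP[].
apply: le_trans (ler_wpM2l _ H) _; first by rewrite exprn_ge0 // ltW.
have -> : Q ^+ k.+1 * (#|O|%:R * (Q * (2 * mu) ^+ k.+2 + 20 * #|A i|%:R * e ^+ k.+2))
  = #|O|%:R * (2 ^+ k.+2 * (e ^+ k.+2) ^+ 2
      + 20 / C * e ^+ k.+2 * (C * #|A i|%:R * Q ^+ k.+1)).
  rewrite exprMn expr_div_n -(exprM e) mulnC (exprM e) (exprS Q k.+1).
  by field; rewrite !expf_neq0 ?gt_eqF // ltr0n (leq_trans _ q5).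
rewrite -[leRHS]mulrA; apply: ler_wpM2l => //; rewrite [leRHS]mulrDl lerD2l expr2 [leRHS]mulrA.
apply: ler_wpM2l => //; rewrite mulr_ge0 ?exprn_ge0 // divr_ge0 //; exact: ltW.
Qed.

End Moments.

(** * The lower bound for the number of classes *)

Lemma min_card_attained (F : finFieldType) d (A : 'I_d -> {set F}) :
  (0 < d)%N -> exists i, (#|A i| <= min_card A)%N.
Proof.
move=> d0; apply: (big_ind (fun m => exists i, #|A i| <= m)%N) => [|m n [i im] [j jn]|i _].
(* The starting value [#|F|] of the minimum is at least every [#|A i|], so any index does. *)
- by exists (Ordinal d0); apply: max_card.
- by case: (leqP m n) => _; [exists i | exists j].
- by exists i.
Qed.

(** The reflector count requires [5 <= q], which leaves [q = 3] to be treated separately. *)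
Lemma odd_card_field (F : finFieldType) : odd #|F| -> #|F| = 3 \/ (5 <= #|F|)%N.
Proof. by have := finNzRing_gt1 F; case: #|F| => [|[|[|[|[|n]]]]]; auto. Qed.

(* The constant c depends only on d, k and the implied constant C of the
   hypothesis, not on the field or on the sets. *)
Theorem theorem1p2 (R : realType) (d k : nat) (hk : (1 <= k <= d)%N)
    (C : R) (hC : 0 < C) :
  exists c : R, 0 < c /\
    forall (F : finFieldType) (A : 'I_d -> {set F}),
      odd #|F| ->
      C * #|F|%:R ^+ (k * d) <=
        (min_card A)%:R^-1 * #|cartesian A|%:R ^+ k.+1 ->
      c * #|F|%:R ^+ 'C(k.+1, 2) <=
        #|determined_classes k (cartesian A)|%:R.
Proof.
case: k hk => [//|k] /andP[_ kd].
(* The first factor comes from [card_congruences], the second from [high_moment]. *)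
pose K : R := 2 ^+ k.+1 * (2 ^+ k.+2 + 20 / C).
have K0 : 0 < K by rewrite mulr_gt0 ?exprn_gt0 // addr_gt0 ?exprn_gt0 // divr_gt0.
have c0 : 0 < K + 3 ^+ 'C(k.+2, 2) by rewrite addr_gt0 // exprn_gt0.
(* The summand [3 ^+ 'C(k.+2, 2)] serves [q = 3], where the existence of one class suffices. *)
exists (K + 3 ^+ 'C(k.+2, 2))^-1; split=> [|F A oF hE]; first by rewrite invr_gt0.
rewrite ler_pdivrMl // mulrDl.
set E := cartesian A in hE *; set N := #|determined_classes k.+1 E|.
have q0 : (0 < #|F|)%N by rewrite (ltn_trans _ (finNzRing_gt1 F)).
have lhs0 : 0 < C * #|F|%:R ^+ (k.+1 * d) by rewrite mulr_gt0 ?exprn_gt0 ?ltr0n.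
have rhs0 := lt_le_trans lhs0 hE.
(* As [0^-1 = 0], a vanishing minimum would make the right side of the hypothesis 0, although its
   left side is positive. *)
have a0 : (0 < min_card A)%N.
  by rewrite lt0n; apply: contraTneq rhs0 => ->; rewrite invr0 mul0r ltxx.
have e0 : (0 < #|E|)%N.
  by rewrite lt0n; apply: contraTneq rhs0 => ->; rewrite expr0n mulr0 ltxx.
have CS := sqr_card_simplices_le k.+1 E.
rewrite card_simplices in CS.
have N0 : (0 < N)%N.
  rewrite lt0n; apply: contraTneq CS; rewrite -/N => ->.
  by rewrite -ltnNge mul0n !expn_gt0 e0.
have [q3|q5] := odd_card_field oF.
  rewrite q3; apply: ler_wpDl; first by rewrite mulr_ge0 ?ler0n // ltW.
  by rewrite ler_peMr ?exprn_ge0 // ler1n.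
apply: ler_wpDr; first by rewrite mulr_ge0 ?exprn_ge0.
have [i ai] := min_card_attained A (leq_trans (ltn0Sn k) kd).
have hE' : C * #|A i|%:R * (#|F|%:R ^+ d) ^+ k.+1 <= #|E|%:R ^+ k.+2.
  rewrite -exprM mulnC mulrAC; apply: le_trans (_ : C * #|F|%:R ^+ (k.+1 * d) * (min_card A)%:R <= _).
    by rewrite ler_wpM2l ?ler_nat // ltW.
  by rewrite -ler_pdivlMr ?ltr0n // [leRHS]mulrC.
have := high_moment oF q5 hC hE'; rewrite -/E -sum_congruences.
set P := (\sum_(x in simplices k.+1 E) \sum_(y in _) congruent x y)%N in CS.
set T := (\sum_(x in _) _)%N => MT.
set O := orthogonal_group F d in MT.
have O0 : (0 < #|O|)%N := card_ortho_gt0 F d.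
(* Every congruent pair carries many congruences, so [T] bounds the number [P] of such pairs. *)
have PT : (#|F| ^ 'C(k.+2, 2) * #|O| * P <= (2 * #|F| ^ d) ^ k.+1 * T)%N.
  rewrite /P /T !big_distrr; apply: leq_sum => x _; rewrite !big_distrr.
  apply: leq_sum => y _ /=; have [xy|] := boolP (congruent x y); last by rewrite muln0.
  by rewrite muln1 card_congruences.
have {}PT : #|F|%:R ^+ 'C(k.+2, 2) * P%:R <= K * (#|E|%:R ^+ k.+2) ^+ 2.
  rewrite -(ler_pM2l (_ : 0 < #|O|%:R)) ?ltr0n //.
  rewrite -(ler_nat R) !(natrM, natrX) in PT.
  rewrite mulrA (mulrC #|O|%:R); apply: le_trans PT _.
  rewrite exprMn -mulrA; apply: le_trans (ler_wpM2l _ MT) _; first exact: exprn_ge0.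
  by rewrite le_eqVlt; apply/orP; left; apply/eqP; rewrite /K; ring.
rewrite -(ler_nat R) !(natrM, natrX) -/N in CS.
have e2 : 0 < (#|E|%:R ^+ k.+2) ^+ 2 :> R by rewrite !exprn_gt0 // ltr0n.
(* With [M = (#|E| ^ k.+2) ^ 2] and [b = 'C(k.+2, 2)]: [q^b M <= q^b N P <= K N M], and [M]
   cancels. *)
rewrite -(ler_pM2r e2); apply: le_trans (ler_wpM2l _ CS) _; first exact: exprn_ge0.
by rewrite mulrCA [leRHS]mulrAC mulrC ler_wpM2r.
Qed.
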